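(* Let $n,k$ be integers with $1<k<n$, and let $$\psi(z)=\frac{1}{2\pi i}\int_{|w|=1}w^{k-2}\exp\left\{\frac{z}{w}-\frac{1}{(n-k+1)w^{n-k+1}}-\frac{w^{k-1}}{k-1}\right\}dw .$$ If $n$ is even and $k$ is odd, then $\psi$ is an even function that is unbounded on every ray from the origin.
   Context: The circle $|w|=1$ is traversed once counterclockwise. A ray from the origin is a set $\{re^{i\theta}: r\ge 0\}$ with $\theta\in\mathbb{R}$ fixed. *)

(* Defs.v *)
From Stdlib Require Import Reals Arith.
From Coquelicot Require Import Coquelicot.

Open Scope C_scope.

Definition Cexp (z : C) : C :=
  (exp (Re z) * cos (Im z), exp (Re z) * sin (Im z))%R.

(** The circle is parametrized by [w = exp (i t)], [0 <= t <= 2 * PI], so that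
    [dw = i * w dt]; the integral in [t] is taken in the real normed module
    underlying [C]. *)
Definition circle_integral (f : C -> C) : C :=
  RInt (V := C_R_CompleteNormedModule)
    (fun t : R => f (Cexp (Ci * t)) * (Ci * Cexp (Ci * t))) 0 (2 * PI).

(** For [1 < k < n] the natural-number subtractions below are not truncated. *)
Definition psi (n k : nat) (z : C) : C :=
  / (2 * PI * Ci) *
  circle_integral (fun w : C =>
    w ^ (k - 2) *
    Cexp (z / w
          - / (INR (n - k + 1) * w ^ (n - k + 1))
          - w ^ (k - 1) / INR (k - 1))).

Definition even_function (f : C -> C) : Prop :=
  forall z : C, f (- z) = f z.

Definition ray (theta : R) (z : C) : Prop :=
  exists r : R, (0 <= r)%R /\ z = r * Cexp (Ci * theta).

Definition unbounded_on (f : C -> C) (S : C -> Prop) : Prop :=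
  forall M : R, exists z : C, S z /\ (M < Cmod (f z))%R.

(* Main.v *)
Require Import Defs.
From Stdlib Require Import Reals Arith Lra Lia Classical.
From Coquelicot Require Import Coquelicot.

(** Put [m = n - k + 1] and [p = k - 1], both even. Along a line
    [z = x e^(i theta)], [2 PI psi] is [f_0 x], where
    [f_q x = int_0^(2 PI) w^p v^q exp (x v - w^-m / m - w^p / p) dt],
    [w = e^(r + i t)], [v = e^(i theta) / w], and [f_(q+1)] is the derivative of
    [f_q]. The integral does not depend on [r], so the frequencies [v] may be
    taken arbitrarily small: [f_q] has exponential type zero. Hence, if it is
    bounded on the real line, its derivative vanishes. Indeed the central
    difference [(f (x + h) - f (x - h)) / 2] multiplies the integrand by
    [sinh (h v)] and does not increase the supremum [M] of [|f_q|], while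
    [h v] is the arcsinh series in [sinh (h v)] as soon as [h v] is small;
    the absolute values of its coefficients having sum at most 2, this gives
    [h |f_(q+1)| <= 2 M] for every [h > 0].
    As [psi] is even (substitute [- w] for [w]), boundedness on one ray is
    boundedness on a line, so all derivatives of [f_0] would vanish identically.
    But [f_p 0] is [e^(i p theta)] times the integral of a function
    with positive real part. *)

Open Scope R_scope.

(** * Circle integrals of complex functions of a real variable *)

(** The equality may be typed at a structure carrier convertible to [C]; restating it at [C] lets
    [ring] recognise the field. *)
Ltac cring := cbv beta; match goal with |- @eq _ ?a ?b => change (@eq C a b); ring end.

Lemma Cexp_plus (z w : C) : Cexp (z + w)%C = (Cexp z * Cexp w)%C.
Proof.
  unfold Cexp, Cmult; destruct z as [a b], w as [c d]; simpl.
  rewrite exp_plus, cos_plus, sin_plus; f_equal; ring.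
Qed.

Lemma Cmod_Cexp (z : C) : Cmod (Cexp z) = exp (Re z).
Proof.
  unfold Cmod, Cexp; simpl fst; simpl snd.
  replace (_ + _) with (Rsqr (exp (Re z)) * (Rsqr (sin (Im z)) + Rsqr (cos (Im z))))
    by (unfold Rsqr; ring).
  rewrite sin2_cos2, Rmult_1_r; apply sqrt_Rsqr, Rlt_le, exp_pos.
Qed.

Lemma Cexp_0 : Cexp 0 = 1%C.
Proof.
  unfold Cexp; simpl; rewrite exp_0, cos_0, sin_0.
  apply injective_projections; simpl; ring.
Qed.

Lemma Cexp_pow (z : C) (n : nat) : (Cexp z ^ n)%C = Cexp (INR n * z)%C.
Proof.
  induction n as [|n IH].
  - simpl Cpow. replace (INR 0 * z)%C with (RtoC 0) by (simpl INR; cring).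
    now rewrite Cexp_0.
  - rewrite Cpow_S, IH, <- Cexp_plus, S_INR, RtoC_plus. f_equal; cring.
Qed.

Lemma Cexp_neq_0 (z : C) : Cexp z <> 0%C.
Proof. apply Cmod_gt_0; rewrite Cmod_Cexp; apply exp_pos. Qed.

Lemma Cexp_opp (z : C) : Cexp (- z)%C = (/ Cexp z)%C.
Proof.
  assert (H : (Cexp (- z) * Cexp z)%C = 1%C).
  { rewrite <- Cexp_plus, <- Cexp_0; f_equal; cring. }
  rewrite <- (Cmult_1_l (/ Cexp z)), <- H; field; apply Cexp_neq_0.
Qed.

(** Continuity is kept componentwise because integrals and derivatives below are all computed on
    real and imaginary parts. *)
Definition ccont (f : R -> C) : Prop :=
  forall t, continuous (fun t => Re (f t)) t /\ continuous (fun t => Im (f t)) t.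

Lemma ccont_const (c : C) : ccont (fun _ => c).
Proof. intro t; split; apply continuous_const. Qed.

Lemma ccont_plus (f g : R -> C) : ccont f -> ccont g -> ccont (fun t => f t + g t)%C.
Proof.
  intros Hf Hg t; destruct (Hf t), (Hg t); split; simpl;
    now apply (continuous_plus (V := R_NormedModule)).
Qed.

Lemma ccont_opp (f : R -> C) : ccont f -> ccont (fun t => - f t)%C.
Proof.
  intros Hf t; destruct (Hf t); split; simpl;
    now apply (continuous_opp (V := R_NormedModule)).
Qed.

Lemma ccont_mult (f g : R -> C) : ccont f -> ccont g -> ccont (fun t => f t * g t)%C.
Proof.
  intros Hf Hg t; destruct (Hf t), (Hg t); split; simpl.
  - apply (continuous_minus (V := R_NormedModule)); now apply (continuous_mult (K := R_AbsRing)).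
  - apply (continuous_plus (V := R_NormedModule)); now apply (continuous_mult (K := R_AbsRing)).
Qed.

Lemma ccont_Cexp (f : R -> C) : ccont f -> ccont (fun t => Cexp (f t)).
Proof.
  intros Hf t; destruct (Hf t); split; simpl; apply (continuous_mult (K := R_AbsRing)).
  1,3: now apply continuous_exp_comp.
  1: now apply continuous_cos_comp.
  now apply continuous_sin_comp.
Qed.

Lemma ccont_pow (f : R -> C) (n : nat) : ccont f -> ccont (fun t => f t ^ n)%C.
Proof.
  intro Hf; induction n; simpl Cpow.
  - apply ccont_const.
  - now apply ccont_mult.
Qed.

Definition Cint (f : R -> C) : C := RInt (V := C_R_CompleteNormedModule) f 0 (2 * PI).

Lemma ccont_ex_RInt (f : R -> C) (a b : R) :
  ccont f -> ex_RInt (V := C_R_NormedModule) f a b.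
Proof.
  intro Hf; apply (ex_RInt_fct_extend_pair (U := R_NormedModule) (V := R_NormedModule));
    apply (ex_RInt_continuous (V := R_CompleteNormedModule)); intros t _; apply Hf.
Qed.

Lemma Cint_pair (f : R -> C) : ccont f ->
  Cint f = (RInt (fun t => Re (f t)) 0 (2 * PI), RInt (fun t => Im (f t)) 0 (2 * PI)).
Proof.
  intro Hf; apply (is_RInt_unique (V := C_R_CompleteNormedModule)).
  apply (is_RInt_fct_extend_pair (U := R_NormedModule) (V := R_NormedModule));
    apply (RInt_correct (V := R_CompleteNormedModule));
    apply (ex_RInt_continuous (V := R_CompleteNormedModule)); intros t _; apply Hf.
Qed.

Lemma Cint_ext (f g : R -> C) : (forall t, f t = g t) -> Cint f = Cint g.
Proof. intro H; apply (RInt_ext (V := C_R_CompleteNormedModule)); intros; apply H. Qed.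

Lemma Cint_plus (f g : R -> C) : ccont f -> ccont g ->
  Cint (fun t => f t + g t)%C = (Cint f + Cint g)%C.
Proof.
  intros Hf Hg; apply (RInt_plus (V := C_R_CompleteNormedModule)); now apply ccont_ex_RInt.
Qed.

(** The integral lives in a real normed module, so linearity over a complex constant is obtained
    from the two components. *)
Lemma Cint_scal (c : C) (f : R -> C) : ccont f ->
  Cint (fun t => c * f t)%C = (c * Cint f)%C.
Proof.
  intros Hf.
  assert (I1 : ex_RInt (fun t => Re (f t)) 0 (2 * PI))
    by (apply (ex_RInt_continuous (V := R_CompleteNormedModule)); intros t _; apply Hf).
  assert (I2 : ex_RInt (fun t => Im (f t)) 0 (2 * PI))
    by (apply (ex_RInt_continuous (V := R_CompleteNormedModule)); intros t _; apply Hf).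
  rewrite !Cint_pair; [| easy | apply ccont_mult; [apply ccont_const | easy]].
  apply injective_projections; simpl; apply is_RInt_unique.
  - apply (is_RInt_minus (V := R_NormedModule));
      apply (is_RInt_scal (V := R_NormedModule));
      now apply (RInt_correct (V := R_CompleteNormedModule)).
  - apply (is_RInt_plus (V := R_NormedModule));
      apply (is_RInt_scal (V := R_NormedModule));
      now apply (RInt_correct (V := R_CompleteNormedModule)).
Qed.

Lemma Cint_norm (f : R -> C) (K : R) : ccont f ->
  (forall t, Cmod (f t) <= K) -> Cmod (Cint f) <= 2 * PI * K.
Proof.
  intros Hf HK. rewrite Cmod_norm.
  replace (2 * PI * K) with ((2 * PI - 0) * K) by ring.
  apply (norm_RInt_le_const (V := C_R_NormedModule) f).
  - generalize PI_RGT_0; lra.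
  - intros t _; rewrite <- Cmod_norm; apply HK.
  - apply (RInt_correct (V := C_R_CompleteNormedModule)); now apply ccont_ex_RInt.
Qed.

(** * Independence of the radius *)

(** The hypotheses on [u], [v] are Cauchy-Riemann equations in the coordinates
    [r + i t]: [d_r u = d_t v], and the integral of [d_t v] over a period is 0. *)
Lemma contour_shift (u v g : R -> R -> R) (a b : R) :
  (forall r t, is_derive (fun r => u r t) r (g r t)) ->
  (forall r t, is_derive (v r) t (g r t)) ->
  (forall r t, continuity_2d_pt g r t) ->
  (forall r t, continuous (u r) t) ->
  (forall r, v r b = v r a) ->
  forall r s, RInt (u r) a b = RInt (u s) a b.
Proof.
  intros Hu Hv Hg Hc Hper.
  assert (D : forall r, is_derive (fun r => RInt (u r) a b) r 0).
  { intro r.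
    replace 0 with (RInt (fun t => Derive (fun r => u r t) r) a b).
    - apply (is_derive_RInt_param (fun r t => u r t)).
      + apply filter_forall; intros x t _; eexists; apply Hu.
      + intros t _; apply continuity_2d_pt_ext with g; [| apply Hg].
        intros x y; symmetry; apply is_derive_unique, Hu.
      + apply filter_forall; intros x.
        apply (ex_RInt_continuous (V := R_CompleteNormedModule)); intros; apply Hc.
    - rewrite (RInt_ext (V := R_CompleteNormedModule) _ (g r))
        by (intros; apply is_derive_unique, Hu).
      apply is_RInt_unique.
      replace 0 with (minus (v r b) (v r a))
        by (rewrite Hper; apply (plus_opp_r (G := R_AbelianGroup))).
      apply (is_RInt_derive (V := R_CompleteNormedModule)); intros t _; [apply Hv |].
      apply continuity_pt_filterlim.
      intros eps Heps; destruct (Hg r t (mkposreal eps Heps)) as [d Hd].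
      exists d; split; [apply cond_pos |].
      intros y [_ Hy]; apply Hd; [rewrite Rminus_diag, Rabs_R0; apply cond_pos | apply Hy]. }
  assert (W : forall r s, r < s -> RInt (u r) a b = RInt (u s) a b).
  { intros r s Hrs.
    apply (eq_is_derive (V := R_NormedModule) (fun r => RInt (u r) a b)); [| easy].
    intros t _; apply D. }
  intros r s; destruct (Rtotal_order r s) as [H | [-> | H]]; [| easy |].
  - now apply W.
  - symmetry; now apply W.
Qed.

(** [kern] is [w^p v^q exp (x v - w^-m / m - w^p / p)] at [w = e^(r + i t)],
    [v = e^(i th) / w]; [ampl] and [phase] are the real and imaginary parts of its
    logarithm, with [r]-derivatives [ampl'] and [phase']. *)
Definition ampl (m p q : nat) (th x r t : R) : R :=
  (INR p - INR q) * r + x * (exp (- r) * cos (th - t))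
  - exp (- (INR m * r)) * cos (INR m * t) / INR m
  - exp (INR p * r) * cos (INR p * t) / INR p.

Definition phase (m p q : nat) (th x r t : R) : R :=
  INR p * t + INR q * (th - t) + x * (exp (- r) * sin (th - t))
  + exp (- (INR m * r)) * sin (INR m * t) / INR m
  - exp (INR p * r) * sin (INR p * t) / INR p.

Definition kern (m p q : nat) (th x r t : R) : C :=
  Cexp (ampl m p q th x r t, phase m p q th x r t).

Definition ampl' (m p q : nat) (th x r t : R) : R :=
  (INR p - INR q) - x * (exp (- r) * cos (th - t))
  + exp (- (INR m * r)) * cos (INR m * t)
  - exp (INR p * r) * cos (INR p * t).

Definition phase' (m p q : nat) (th x r t : R) : R :=
  - (x * (exp (- r) * sin (th - t)))
  - exp (- (INR m * r)) * sin (INR m * t)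
  - exp (INR p * r) * sin (INR p * t).

Ltac solve_2d := repeat first
  [ apply continuity_2d_pt_const | apply continuity_2d_pt_id1 | apply continuity_2d_pt_id2
  | apply continuity_2d_pt_minus | apply continuity_2d_pt_plus | apply continuity_2d_pt_opp
  | apply continuity_2d_pt_mult
  | apply (continuity_1d_2d_pt_comp exp); [apply derivable_continuous_pt, derivable_pt_exp |]
  | apply (continuity_1d_2d_pt_comp cos); [apply continuity_cos |]
  | apply (continuity_1d_2d_pt_comp sin); [apply continuity_sin |] ].

Lemma kern_ccont m p q th x r : ccont (kern m p q th x r).
Proof.
  unfold kern, ampl, phase, Cexp; intro t; split; simpl;
  apply (ex_derive_continuous (K := R_AbsRing) (V := R_NormedModule)); auto_derive; auto.
Qed.

Lemma kern_periodic m p q th x r t : kern m p q th x r (t + 2 * PI) = kern m p q th x r t.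
Proof.
  assert (cZ : forall n x, cos (x + INR n * (2 * PI)) = cos x)
    by (intros n y; rewrite <- (cos_period y n); f_equal; ring).
  assert (sZ : forall n x, sin (x + INR n * (2 * PI)) = sin x)
    by (intros n y; rewrite <- (sin_period y n); f_equal; ring).
  assert (c1 : cos (th - (t + 2 * PI)) = cos (th - t))
    by (rewrite <- (cZ 1%nat); f_equal; simpl; ring).
  assert (s1 : sin (th - (t + 2 * PI)) = sin (th - t))
    by (rewrite <- (sZ 1%nat); f_equal; simpl; ring).
  assert (c0 : forall n, cos (INR n * (t + 2 * PI)) = cos (INR n * t))
    by (intro n; rewrite <- (cZ n (INR n * t)); f_equal; ring).
  assert (s0 : forall n, sin (INR n * (t + 2 * PI)) = sin (INR n * t))
    by (intro n; rewrite <- (sZ n (INR n * t)); f_equal; ring).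
  assert (HA : ampl m p q th x r (t + 2 * PI) = ampl m p q th x r t)
    by (unfold ampl; now rewrite c1, !c0).
  set (P := phase m p q th x r t).
  (* Over a period the phase grows by [2 * PI] times [p - q], possibly negative; the [q] turns go to
     the left so that both sides add a natural number of turns. *)
  assert (HB : phase m p q th x r (t + 2 * PI) + INR q * (2 * PI) = P + INR p * (2 * PI))
    by (unfold P, phase; rewrite s1, !s0; ring).
  unfold kern, Cexp; simpl; fold P; rewrite HA.
  rewrite <- (cZ q (phase _ _ _ _ _ _ (t + 2 * PI))), <- (sZ q (phase _ _ _ _ _ _ (t + 2 * PI))).
  now rewrite HB, cZ, sZ.
Qed.

(** Cauchy's theorem for concentric circles: [ampl] and [phase] satisfy the Cauchy-Riemann equations
    in r + i t, hence so do the parts of the exponential, and periodicity in t removes the boundary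
    terms. *)
Lemma kern_shift m p q th x r s : (0 < m)%nat -> (0 < p)%nat ->
  Cint (kern m p q th x r) = Cint (kern m p q th x s).
Proof.
  intros Hm Hp; apply lt_0_INR in Hm, Hp.
  rewrite !Cint_pair by apply kern_ccont.
  set (A := ampl m p q th x); set (B := phase m p q th x).
  set (A' := ampl' m p q th x); set (B' := phase' m p q th x).
  assert (HA2 : forall r t, continuity_2d_pt A r t) by (intros; unfold A, ampl, Rdiv; solve_2d).
  assert (HB2 : forall r t, continuity_2d_pt B r t) by (intros; unfold B, phase, Rdiv; solve_2d).
  assert (HA2' : forall r t, continuity_2d_pt A' r t) by (intros; unfold A', ampl'; solve_2d).
  assert (HB2' : forall r t, continuity_2d_pt B' r t) by (intros; unfold B', phase'; solve_2d).
  assert (Ar : forall r t, is_derive (fun r => A r t) r (A' r t))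
    by (intros; unfold A, A', ampl, ampl'; auto_derive; [easy | unfold Rminus; field; lra]).
  assert (Br : forall r t, is_derive (fun r => B r t) r (B' r t))
    by (intros; unfold B, B', phase, phase'; auto_derive; [easy | unfold Rminus; field; lra]).
  assert (At : forall r t, is_derive (A r) t (- B' r t))
    by (intros; unfold A, B', ampl, phase'; auto_derive; [easy | unfold Rminus; field; lra]).
  assert (Bt : forall r t, is_derive (B r) t (A' r t))
    by (intros; unfold B, A', phase, ampl'; auto_derive; [easy | unfold Rminus; field; lra]).
  assert (DAr : forall r t, Derive (fun x : R => A x t) r = A' r t)
    by (intros; apply is_derive_unique, Ar).
  assert (DBr : forall r t, Derive (fun x : R => B x t) r = B' r t)
    by (intros; apply is_derive_unique, Br).
  assert (DAt : forall r t, Derive (fun x : R => A r x) t = - B' r t)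
    by (intros; apply is_derive_unique, At).
  assert (DBt : forall r t, Derive (fun x : R => B r x) t = A' r t)
    by (intros; apply is_derive_unique, Bt).
  f_equal.
  - apply (contour_shift (fun r t => exp (A r t) * cos (B r t))
      (fun r t => exp (A r t) * sin (B r t))
      (fun r t => exp (A r t) * (A' r t * cos (B r t) - B' r t * sin (B r t)))).
    + intros; auto_derive.
      * repeat split; eexists; eauto.
      * rewrite DAr, DBr; ring.
    + intros; auto_derive.
      * repeat split; eexists; eauto.
      * rewrite DAt, DBt; ring.
    + intros; cbv beta; solve_2d; auto.
    + intros a t; destruct (kern_ccont m p q th x a t) as [H _]; exact H.
    + intros a; assert (H := kern_periodic m p q th x a 0); rewrite Rplus_0_l in H.
      exact (f_equal Im H).
  (* The same argument for -i times the kernel: its real part is the former imaginary part, its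
     imaginary part minus the former real part. *)
  - apply (contour_shift (fun r t => exp (A r t) * sin (B r t))
      (fun r t => - (exp (A r t) * cos (B r t)))
      (fun r t => exp (A r t) * (A' r t * sin (B r t) + B' r t * cos (B r t)))).
    + intros; auto_derive.
      * repeat split; eexists; eauto.
      * rewrite DAr, DBr; ring.
    + intros; auto_derive.
      * repeat split; eexists; eauto.
      * rewrite DAt, DBt; ring.
    + intros; cbv beta; solve_2d; auto.
    + intros a t; destruct (kern_ccont m p q th x a t) as [_ H]; exact H.
    + intros a; assert (H := kern_periodic m p q th x a 0); rewrite Rplus_0_l in H.
      f_equal; exact (f_equal Re H).
Qed.

(** * The arcsinh series in the complex domain *)

(** All estimates run along a segment t z with 0 <= t <= 1, so a derivative in the real parameter
    takes the place of complex differentiability. *)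
Definition cder (f : R -> C) (t : R) (l : C) : Prop :=
  is_derive (fun t => Re (f t)) t (Re l) /\ is_derive (fun t => Im (f t)) t (Im l).

Lemma cder_eq f t l l' : cder f t l -> l = l' -> cder f t l'.
Proof. now intros H <-. Qed.

Lemma cder_const c t : cder (fun _ => c) t 0%C.
Proof. split; apply (is_derive_const (V := R_NormedModule)). Qed.

Lemma cder_plus f g t l k : cder f t l -> cder g t k ->
  cder (fun t => f t + g t)%C t (l + k)%C.
Proof.
  intros [? ?] [? ?]; split; simpl; now apply (is_derive_plus (V := R_NormedModule)).
Qed.

Lemma cder_mult f g t l k : cder f t l -> cder g t k ->
  cder (fun t => f t * g t)%C t (l * g t + f t * k)%C.
Proof.
  intros [F1 F2] [G1 G2]; split.
  - evar_last.
    + apply (is_derive_minus (V := R_NormedModule)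
        (fun t => Re (f t) * Re (g t)) (fun t => Im (f t) * Im (g t)));
      apply (is_derive_mult (K := R_AbsRing)); eauto; apply Rmult_comm.
    + unfold minus, plus, opp, mult, Re, Im; simpl; ring.
  - evar_last.
    + apply (is_derive_plus (V := R_NormedModule)
        (fun t => Re (f t) * Im (g t)) (fun t => Im (f t) * Re (g t)));
      apply (is_derive_mult (K := R_AbsRing)); eauto; apply Rmult_comm.
    + unfold minus, plus, opp, mult, Re, Im; simpl; ring.
Qed.

Lemma cder_scal c f t l : cder f t l -> cder (fun t => c * f t)%C t (c * l)%C.
Proof.
  intro H; eapply cder_eq; [apply cder_mult; [apply cder_const | exact H] | cring].
Qed.

Lemma cder_pow f t l n : cder f t l ->
  cder (fun t => f t ^ S n)%C t (INR (S n) * f t ^ n * l)%C.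
Proof.
  intro H; induction n as [|n IH].
  - eapply cder_eq; [apply cder_mult; [exact H | apply cder_const] |].
    simpl; cring.
  - eapply cder_eq; [apply (cder_mult f (fun t => f t ^ S n)%C); [exact H | exact IH] |].
    rewrite (S_INR (S n)), RtoC_plus, !Cpow_S; cring.
Qed.

Lemma cder_Cexp (z : C) t : cder (fun t => Cexp (t * z)%C) t (z * Cexp (t * z))%C.
Proof.
  split; unfold Cexp; simpl; auto_derive; auto; unfold Rminus; ring.
Qed.

Lemma Cmod_le_abs (z : C) : Cmod z <= Rabs (Re z) + Rabs (Im z).
Proof.
  destruct z as [a b].
  replace ((a, b) : C) with (RtoC a + RtoC b * Ci)%C
    by (apply injective_projections; simpl; ring).
  eapply Rle_trans; [apply Cmod_triangle |].
  rewrite Cmod_mult, Cmod_Ci, !Cmod_R; simpl.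
  rewrite !Rmult_0_r, Rmult_1_r, !Rmult_0_l, Rminus_0_r, Rplus_0_r, Rplus_0_l.
  rewrite Rmult_1_r, Rplus_0_r; lra.
Qed.

Lemma im_le_Cmod (z : C) : Rabs (Im z) <= Cmod z.
Proof. eapply Rle_trans; [apply Rmax_r | apply Rmax_Cmod]. Qed.

(** The mean value theorem holds for real functions only; it is applied to each component, which
    costs the factor 2. *)
Lemma cder_bound f f' L t : 0 <= t <= 1 ->
  (forall s, 0 <= s <= 1 -> cder f s (f' s) /\ Cmod (f' s) <= L) ->
  Cmod (f t - f 0)%C <= 2 * L.
Proof.
  intros Ht H.
  assert (HL : 0 <= L) by (eapply Rle_trans; [apply Cmod_ge_0 | apply (H t Ht)]).
  assert (M : forall (g g' : R -> R), 
      (forall s, 0 <= s <= 1 -> is_derive g s (g' s) /\ Rabs (g' s) <= L) ->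
    Rabs (g t - g 0) <= L).
  { intros g g' Hg.
    destruct (MVT_gen g 0 t g') as [c [Hc ->]].
    - rewrite Rmin_left, Rmax_right by lra; intros x Hx; apply Hg; lra.
    - rewrite Rmin_left, Rmax_right by lra; intros x Hx.
      apply derivable_continuous_pt; exists (g' x); apply is_derive_Reals, Hg; lra.
    - rewrite Rmin_left, Rmax_right in Hc by lra.
      rewrite Rabs_mult, Rminus_0_r, (Rabs_right t) by lra.
      destruct (Hg c); [lra |].
      apply Rle_trans with (L * 1); [| lra].
      apply Rmult_le_compat; try lra; apply Rabs_pos. }
  eapply Rle_trans; [apply Cmod_le_abs |].
  replace (2 * L) with (L + L) by ring; apply Rplus_le_compat; simpl.
  - apply (M (fun t => Re (f t)) (fun t => Re (f' t))).
    intros s Hs; destruct (H s Hs) as [[D1 D2] B]; split; [exact D1 |].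
    eapply Rle_trans; [apply re_le_Cmod | exact B].
  - apply (M (fun t => Im (f t)) (fun t => Im (f' t))).
    intros s Hs; destruct (H s Hs) as [[D1 D2] B]; split; [exact D2 |].
    eapply Rle_trans; [apply im_le_Cmod | exact B].
Qed.

Definition csinh (z : C) : C := ((Cexp z - Cexp (- z)) / 2)%C.
Definition ccosh (z : C) : C := ((Cexp z + Cexp (- z)) / 2)%C.

Lemma Cexp_mul_opp z : (Cexp z * Cexp (- z))%C = 1%C.
Proof. rewrite <- Cexp_plus, <- Cexp_0; f_equal; cring. Qed.

Lemma two_neq_0 : RtoC 2 <> 0%C.
Proof. intro H; apply RtoC_inj in H; lra. Qed.

Lemma ccosh_sq z : (ccosh z * ccosh z = 1 + csinh z * csinh z)%C.
Proof.
  rewrite <- (Cexp_mul_opp z); unfold csinh, ccosh; field; apply two_neq_0.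
Qed.

Lemma csinh_0 : csinh 0 = 0%C.
Proof.
  unfold csinh; replace (- RtoC 0)%C with (RtoC 0) by cring; field; apply two_neq_0.
Qed.

Lemma ccosh_0 : ccosh 0 = 1%C.
Proof.
  unfold ccosh; replace (- RtoC 0)%C with (RtoC 0) by cring.
  rewrite Cexp_0; field; apply two_neq_0.
Qed.

Lemma cder_ext f g t l : (forall t, f t = g t) -> cder f t l -> cder g t l.
Proof.
  intros H [F1 F2]; split; eapply is_derive_ext; try eassumption; intro s; simpl; now rewrite H.
Qed.

Lemma cder_Cexp_opp (z : C) t : cder (fun t => Cexp (- (t * z))%C) t (- z * Cexp (- (t * z)))%C.
Proof.
  apply cder_ext with (fun t => Cexp (t * - z)%C); [intro s; f_equal; cring |].
  eapply cder_eq; [apply cder_Cexp | f_equal; f_equal; cring].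
Qed.

Lemma cder_csinh (z : C) t : cder (fun t => csinh (t * z)%C) t (z * ccosh (t * z))%C.
Proof.
  apply cder_ext with (fun t => / 2 * (Cexp (t * z) + - (1) * Cexp (- (t * z))))%C.
  { intro s; unfold csinh; field; apply two_neq_0. }
  eapply cder_eq; [apply cder_scal, cder_plus; [apply cder_Cexp |] |].
  { apply cder_scal, cder_Cexp_opp. }
  unfold ccosh; field; apply two_neq_0.
Qed.

Lemma cder_ccosh (z : C) t : cder (fun t => ccosh (t * z)%C) t (z * csinh (t * z))%C.
Proof.
  apply cder_ext with (fun t => / 2 * (Cexp (t * z) + Cexp (- (t * z))))%C.
  { intro s; unfold ccosh; field; apply two_neq_0. }
  eapply cder_eq; [apply cder_scal, cder_plus; [apply cder_Cexp | apply cder_Cexp_opp] |].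
  unfold csinh; field; apply two_neq_0.
Qed.

(** The Taylor coefficients of [(1 + y)^(-1/2)]. *)
Fixpoint alpha (i : nat) : R :=
  match i with
  | O => 1
  | S i => - (alpha i * (2 * INR i + 1) / (2 * INR i + 2))
  end.

(** The first [d] terms of the Taylor series of arcsinh, the primitive of (1 + s^2)^(-1/2). *)
Fixpoint arcsinh_sum (d : nat) (s : C) : C :=
  match d with
  | O => 0%C
  | S i => (arcsinh_sum i s + alpha i / (2 * INR i + 1) * s ^ S (2 * i))%C
  end.

Fixpoint rsqrt_sum (d : nat) (s : C) : C :=
  match d with
  | O => 0%C
  | S i => (rsqrt_sum i s + alpha i * s ^ (2 * i))%C
  end.

Lemma arcsinh_sum_S d s : arcsinh_sum (S d) s =
  (arcsinh_sum d s + alpha d / (2 * INR d + 1) * s ^ S (2 * d))%C.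
Proof. reflexivity. Qed.

Lemma abs_alpha_S i : Rabs (alpha (S i)) = Rabs (alpha i) * ((2 * INR i + 1) / (2 * INR i + 2)).
Proof.
  simpl; assert (H := pos_INR i).
  rewrite Rabs_Ropp; unfold Rdiv; rewrite Rmult_assoc, Rabs_mult; f_equal.
  apply Rabs_right, Rle_ge, Rmult_le_pos; [lra |].
  apply Rlt_le, Rinv_0_lt_compat; lra.
Qed.

Lemma abs_alpha_le_1 i : Rabs (alpha i) <= 1.
Proof.
  induction i as [|i IH]; [simpl; rewrite Rabs_R1; lra |].
  rewrite abs_alpha_S; assert (H := pos_INR i).
  replace 1 with (1 * 1) by ring; apply Rmult_le_compat; [apply Rabs_pos | | easy |].
  - apply Rmult_le_pos; [lra |]; apply Rlt_le, Rinv_0_lt_compat; lra.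
  - apply Rle_div_l; lra.
Qed.

(** The ratio of consecutive coefficients makes the right side |alpha_i| / (i + 1). Summed over i,
    this bounds the absolute arcsinh coefficients by 2 in total. *)
Lemma abs_alpha_telescope i :
  Rabs (alpha i) / (2 * INR i + 1) <= 2 * (Rabs (alpha i) - Rabs (alpha (S i))).
Proof.
  rewrite abs_alpha_S; assert (H := pos_INR i); assert (P := Rabs_pos (alpha i)).
  replace (2 * (Rabs (alpha i) - _)) with (Rabs (alpha i) * / (INR i + 1)) by (field; lra).
  apply Rmult_le_compat_l; [easy |]; apply Rinv_le_contravar; lra.
Qed.

Lemma RtoC_2INR i a : (2 * RtoC (INR i) + RtoC a)%C = RtoC (2 * INR i + a).
Proof. now rewrite RtoC_plus, RtoC_mult. Qed.

Lemma odd_neq_0 i : (2 * RtoC (INR i) + 1)%C <> 0%C.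
Proof.
  rewrite RtoC_2INR; intro H; apply RtoC_inj in H; assert (P := pos_INR i); lra.
Qed.

Lemma cder_arcsinh_sum (z : C) d t :
  cder (fun t => arcsinh_sum d (csinh (t * z))) t
    (z * (ccosh (t * z) * rsqrt_sum d (csinh (t * z))))%C.
Proof.
  induction d as [|d IH].
  - apply cder_ext with (fun _ => 0%C); [easy |].
    eapply cder_eq; [apply cder_const | simpl rsqrt_sum; cring].
  - apply cder_ext with (fun t => arcsinh_sum d (csinh (t * z))
        + alpha d / (2 * INR d + 1) * csinh (t * z) ^ S (2 * d))%C; [easy |].
    eapply cder_eq.
    + apply cder_plus; [exact IH |].
      apply cder_scal, (cder_pow (fun t => csinh (t * z))), cder_csinh.
    + change (rsqrt_sum (S d) (csinh (t * z)))
        with (rsqrt_sum d (csinh (t * z)) + alpha d * csinh (t * z) ^ (2 * d))%C.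
      rewrite S_INR, mult_INR, RtoC_plus, RtoC_mult.
      change (INR 2) with 2. field. apply odd_neq_0.
Qed.

Lemma alpha_S_C i : (RtoC (alpha (S i)) * (2 * INR i + 2) = - (alpha i * (2 * INR i + 1)))%C.
Proof.
  rewrite !RtoC_2INR, <- !RtoC_mult, <- RtoC_opp; f_equal; simpl; field.
  assert (P := pos_INR i); lra.
Qed.

(** With [A] the truncated series of [(1 + s^2)^(-1/2)], the sum
    [(1 + s^2) A' + s A] telescopes to a single monomial. *)
Lemma cder_cosh_rsqrt_sum (z : C) d t :
  cder (fun t => ccosh (t * z) * rsqrt_sum (S d) (csinh (t * z)))%C t
    (z * (alpha d * (2 * INR d + 1) * csinh (t * z) ^ S (2 * d)))%C.
Proof.
  induction d as [|d IH].
  - apply cder_ext with (fun t => ccosh (t * z)); [intro s; simpl; cring |].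
    eapply cder_eq; [apply cder_ccosh | simpl; cring].
  - apply cder_ext with
      (fun t => ccosh (t * z) * rsqrt_sum (S d) (csinh (t * z))
        + alpha (S d) * (ccosh (t * z) * csinh (t * z) ^ S (S (2 * d))))%C.
    { intro s; replace (S (S (2 * d))) with (2 * S d)%nat by lia.
      change (rsqrt_sum (S (S d)) (csinh (s * z)))
        with (rsqrt_sum (S d) (csinh (s * z)) + alpha (S d) * csinh (s * z) ^ (2 * S d))%C.
      cring. }
    eapply cder_eq.
    + apply cder_plus; [exact IH |].
      apply cder_scal, (cder_mult (fun t => ccosh (t * z))
        (fun t => csinh (t * z) ^ S (S (2 * d))))%C;
        [apply cder_ccosh | apply (cder_pow (fun t => csinh (t * z))), cder_csinh].
    + replace (2 * S d)%nat with (S (S (2 * d))) by lia.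
      set (s := csinh (t * z)); set (c := ccosh (t * z)).
      rewrite !S_INR, mult_INR, !RtoC_plus, RtoC_mult.
      change (INR 2) with 2. rewrite !Cpow_S.
      set (w := (s ^ (2 * d))%C).
      assert (E1 : (c * c = 1 + s * s)%C) by apply ccosh_sq.
      assert (E2 := alpha_S_C d).
      transitivity (z * (alpha d * (2 * INR d + 1) * (s * w)
         + alpha (S d) * (2 * INR d + 2) * (s * w) * (c * c)
         + alpha (S d) * (s * (s * (s * w)))))%C; [cring |].
      (* With c^2 = 1 + s^2 only the degrees 2d+1 and 2d+3 in s occur; the recurrence for [alpha]
         cancels the lower one. *)
      rewrite E1.
      transitivity (z * ((alpha d * (2 * INR d + 1) + alpha (S d) * (2 * INR d + 2)) * (s * w)
         + alpha (S d) * (2 * (INR d + 1) + 1) * (s * (s * (s * w)))))%C; [cring |].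
      rewrite E2; cring.
Qed.

(** From 1 + x <= exp x at x = -1/8, so that 1 / exp (1/8) >= 7/8. *)
Lemma exp_le_8_7 a : a <= 1/8 -> exp a <= 8/7.
Proof.
  intro H; apply Rle_trans with (exp (1/8)).
  - destruct H as [H | ->]; [left; now apply exp_increasing | right; easy].
  - assert (P := exp_ineq1_le (- (1/8))).
    rewrite exp_Ropp in P; assert (Q := exp_pos (1/8)).
    apply Rmult_le_reg_l with (/ exp (1/8)); [now apply Rinv_0_lt_compat |].
    rewrite Rinv_l by lra; lra.
Qed.

Lemma Cmod_Cexp_small z : Cmod z <= 1/8 -> Cmod (Cexp z) <= 8/7.
Proof.
  intro H; rewrite Cmod_Cexp; apply exp_le_8_7.
  eapply Rle_trans; [| exact H]; eapply Rle_trans; [apply Rle_abs | apply re_le_Cmod].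
Qed.

Lemma Cmod_ccosh_small z : Cmod z <= 1/8 -> Cmod (ccosh z) <= 8/7.
Proof.
  intro H; unfold ccosh; rewrite Cmod_div by apply two_neq_0.
  rewrite Cmod_R, (Rabs_right 2) by lra.
  apply Rle_div_l; [lra |].
  eapply Rle_trans; [apply Cmod_triangle |].
  assert (A := Cmod_Cexp_small z H).
  assert (B := Cmod_Cexp_small (- z)); rewrite Cmod_opp in B; specialize (B H); lra.
Qed.

Lemma segment_small z t : 0 <= t <= 1 -> Cmod z <= 1/8 -> Cmod (t * z) <= 1/8.
Proof.
  intros Ht H; rewrite Cmod_mult, Cmod_R, Rabs_right by lra.
  assert (P := Cmod_ge_0 z); nra.
Qed.

(** The derivative z cosh (t z) is at most 1/8 * 8/7 = 1/7 on the segment, so |sinh z| <= 2/7. The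
    bound 1/2 makes the powers of sinh z decay geometrically. *)
Lemma Cmod_csinh_small z : Cmod z <= 1/8 -> Cmod (csinh z) <= 1/2.
Proof.
  intro H.
  assert (D := cder_bound (fun t => csinh (t * z)) (fun t => z * ccosh (t * z))%C (1/7) 1).
  simpl in D.
  replace (1 * z)%C with z in D by cring.
  replace (0 * z)%C with (RtoC 0) in D by cring.
  rewrite csinh_0 in D; replace (csinh z - 0)%C with (csinh z) in D by cring.
  enough (Cmod (csinh z) <= 2 * (1/7)) by lra; apply D; [lra |].
  intros s Hs; split; [apply cder_csinh |].
  rewrite Cmod_mult; replace (1/7) with (1/8 * (8/7)) by field.
  apply Rmult_le_compat; try apply Cmod_ge_0; [easy |].
  now apply Cmod_ccosh_small, segment_small.
Qed.

Lemma succ_le_pow2 n : INR n + 1 <= 2 ^ n.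
Proof.
  induction n; [simpl; lra |]; rewrite S_INR; simpl pow; assert (P := pos_INR n); lra.
Qed.

Lemma rsqrt_sum_0 d : rsqrt_sum (S d) 0 = 1%C.
Proof.
  induction d; [simpl; cring |].
  change (rsqrt_sum (S (S d)) 0) with (rsqrt_sum (S d) 0 + alpha (S d) * 0 ^ (2 * S d))%C.
  rewrite IHd; replace (2 * S d)%nat with (S (S (2 * d))) by lia; rewrite Cpow_S; cring.
Qed.

Lemma arcsinh_sum_0 d : arcsinh_sum d 0 = 0%C.
Proof.
  induction d; [easy |]; simpl arcsinh_sum; rewrite IHd; simpl Cpow; cring.
Qed.

(** Two integrations along the segment. The product F of cosh and [rsqrt_sum] equals 1 at t = 0 and
    has a tiny monomial as derivative, so F is near 1; and z (F - 1) is the derivative of the error.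
    Neither an inverse function nor a convergent series is involved. *)
Lemma arcsinh_sum_csinh z d : Cmod z <= 1/8 ->
  Cmod (z - arcsinh_sum (S d) (csinh z)) <= (1/2) ^ d.
Proof.
  intro H.
  set (eps := (1/2) ^ d); assert (He : 0 < eps) by (apply pow_lt; lra).
  assert (Q : forall t, 0 <= t <= 1 ->
    Cmod (ccosh (t * z) * rsqrt_sum (S d) (csinh (t * z)) - 1) <= 2 * (1/8 * eps)).
  { intros t Ht.
    assert (D := cder_bound (fun t => ccosh (t * z) * rsqrt_sum (S d) (csinh (t * z)))%C
      (fun t => z * (alpha d * (2 * INR d + 1) * csinh (t * z) ^ S (2 * d)))%C (1/8 * eps) t Ht).
    cbv beta in D.
    replace (0 * z)%C with (RtoC 0) in D by cring.
    rewrite csinh_0, ccosh_0, rsqrt_sum_0, Cmult_1_l in D; apply D; clear D.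
    intros s Hs; split; [apply cder_cosh_rsqrt_sum |].
    rewrite Cmod_mult; apply Rmult_le_compat; try apply Cmod_ge_0; [easy |].
    rewrite RtoC_2INR, !Cmod_mult, Cmod_pow, !Cmod_R.
    assert (P := pos_INR d).
    rewrite (Rabs_right (2 * INR d + 1)) by lra.
    (* Here 2d + 1 <= 2 * 2^d, while the power of sinh is at most 2^-(2d+1); the product is exactly
       [eps]. *)
    apply Rle_trans with (1 * (2 * 2 ^ d) * (1/2) ^ S (2 * d)).
    - apply Rmult_le_compat; [apply Rmult_le_pos; [apply Rabs_pos | lra] | | |].
      + apply pow_le, Cmod_ge_0.
      + apply Rmult_le_compat; [apply Rabs_pos | lra | apply abs_alpha_le_1 |].
        assert (N := succ_le_pow2 d); lra.
      + apply pow_incr; split; [apply Cmod_ge_0 |].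
        now apply Cmod_csinh_small, segment_small.
    - right; unfold eps.
      replace (S (2 * d)) with (d + d + 1)%nat by lia; rewrite !pow_add, pow_1.
      assert (E : 2 ^ d * (1/2) ^ d = 1).
      { rewrite <- Rpow_mult_distr; replace (2 * (1/2)) with 1 by field; apply pow1. }
      transitivity ((2 ^ d * (1/2) ^ d) * (1/2) ^ d);
        [generalize (2 ^ d) ((1/2) ^ d); intros; field | now rewrite E, Rmult_1_l]. }
  (* Second integration: the error is at most 2 * 1/8 * (2 * 1/8 * eps) = eps / 16. *)
  assert (D := cder_bound
    (fun t => arcsinh_sum (S d) (csinh (t * z)) + - z * t)%C
    (fun t => z * (ccosh (t * z) * rsqrt_sum (S d) (csinh (t * z)) - 1))%C
    (1/8 * (2 * (1/8 * eps))) 1).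
  cbv beta in D.
  replace (0 * z)%C with (RtoC 0) in D by cring.
  replace (1 * z)%C with z in D by cring.
  rewrite csinh_0, arcsinh_sum_0 in D.
  rewrite <- Cmod_opp.
  replace (- (z - arcsinh_sum (S d) (csinh z)))%C
    with (arcsinh_sum (S d) (csinh z) + - z * 1 - (0 + - z * 0))%C by cring.
  apply Rle_trans with (2 * (1/8 * (2 * (1/8 * eps)))); [| lra]; apply D; [lra |].
  intros s Hs; split.
  - eapply cder_eq; [apply cder_plus; [apply cder_arcsinh_sum |] |].
    + apply cder_scal with (l := RtoC 1); split; simpl; auto_derive; auto.
    + cring.
  - rewrite Cmod_mult; apply Rmult_le_compat; try apply Cmod_ge_0; auto.
Qed.

(** * Functions of type zero bounded on a line *)

(** The frequency v = e^(i th) / w at w = e^(r + i t). *)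
Definition invw (th r t : R) : C := Cexp (- r, th - t).

Lemma invw_ccont th r : ccont (invw th r).
Proof.
  apply ccont_Cexp; intro t; split; simpl;
  apply (ex_derive_continuous (K := R_AbsRing) (V := R_NormedModule)); auto_derive; auto.
Qed.

(** This stands in for differentiation in x under the integral sign: passing to the next derivative
    multiplies the integrand by v. *)
Lemma kern_S m p q th x r t : kern m p (S q) th x r t = (invw th r t * kern m p q th x r t)%C.
Proof.
  unfold kern, invw; rewrite <- Cexp_plus; f_equal.
  apply injective_projections; unfold ampl, phase; rewrite S_INR; simpl; ring.
Qed.

(** Translation in x acts on the integrand as a multiplier, which turns central differences into
    factors sinh (h v). *)
Lemma kern_translate m p q th x y r t :
  kern m p q th (x + y) r t = (Cexp (y * invw th r t) * kern m p q th x r t)%C.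
Proof.
  unfold kern; rewrite <- Cexp_plus; f_equal.
  apply injective_projections; unfold ampl, phase, invw; simpl; ring.
Qed.

(** Each cosine is bounded by 1. Any bound uniform in t suffices: it multiplies an arcsinh remainder
    that tends to 0. *)
Lemma kern_bounded m p q th x r : (0 < m)%nat -> (0 < p)%nat ->
  exists K, forall t, Cmod (kern m p q th x r t) <= K.
Proof.
  intros Hm Hp; apply lt_0_INR in Hm, Hp.
  exists (exp ((INR p - INR q) * r + Rabs x * exp (- r)
    + exp (- (INR m * r)) / INR m + exp (INR p * r) / INR p)); intro t.
  unfold kern; rewrite Cmod_Cexp; simpl.
  assert (L : forall a b, a <= b -> exp a <= exp b)
    by (intros a b [H | ->]; [left; now apply exp_increasing | right; easy]).
  assert (B : forall c u y, 0 < c -> Rabs y <= 1 -> u * (c * y) <= Rabs u * c).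
  { intros c u y Hc Hy; eapply Rle_trans; [apply Rle_abs |].
    rewrite !Rabs_mult, (Rabs_right c) by lra.
    assert (P := Rabs_pos u); assert (Q := Rabs_pos y).
    apply Rmult_le_compat_l; [easy | nra]. }
  assert (C : forall y, Rabs (cos y) <= 1) by (intro y; apply Rabs_le, COS_bound).
  apply L; unfold ampl.
  assert (B1 := B (exp (- r)) x _ (exp_pos _) (C (th - t))).
  assert (B2 := B (exp (- (INR m * r))) (- / INR m) _ (exp_pos _) (C (INR m * t))).
  assert (B3 := B (exp (INR p * r)) (- / INR p) _ (exp_pos _) (C (INR p * t))).
  rewrite Rabs_Ropp, Rabs_right in B2, B3 by (apply Rle_ge, Rlt_le, Rinv_0_lt_compat; lra).
  lra.
Qed.

Lemma bounded_derivative_zero m p q th M : (0 < m)%nat -> (0 < p)%nat ->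
  (forall x, Cmod (Cint (kern m p q th x 0)) <= M) ->
  forall x, Cint (kern m p (S q) th x 0) = 0%C.
Proof.
  intros Hm Hp HM x.
  assert (Bernstein : forall h, 0 < h -> h * Cmod (Cint (kern m p (S q) th x 0)) <= 2 * M).
  { intros h Hh.
    (* On this circle |h v| = h e^(-r) = 1/8, the radius allowed by [arcsinh_sum_csinh]. *)
    set (r := ln (8 * h)).
    set (X := fun t => (h * invw th r t)%C).
    assert (HX : forall t, Cmod (X t) <= 1/8).
    { intro t; unfold X, invw; rewrite Cmod_mult, Cmod_Cexp, Cmod_R, Rabs_right by lra; simpl.
      unfold r; rewrite exp_Ropp, exp_ln by lra; right; field; lra. }
    assert (cX : ccont X) by (apply ccont_mult; [apply ccont_const | apply invw_ccont]).
    assert (cS : ccont (fun t => csinh (X t))).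
    { unfold csinh, Cdiv, Cminus; apply ccont_mult; [| apply ccont_const].
      apply ccont_plus; [| apply ccont_opp]; apply ccont_Cexp; [easy | now apply ccont_opp]. }
    assert (cK : forall q x, ccont (kern m p q th x r)) by (intros; apply kern_ccont).
    (* The integral is the j-fold central difference of f_q with step h. For j = 0 the circle is
       moved back to radius 1, where [HM] applies; each further difference averages two values
       bounded by [M]. *)
    assert (T : forall j x, Cmod (Cint (fun t => csinh (X t) ^ j * kern m p q th x r t)%C) <= M).
    { induction j as [|j IH]; intro y.
      - rewrite (Cint_ext _ (kern m p q th y r)) by (intro t; simpl Cpow; cring).
        rewrite (kern_shift m p q th y r 0) by easy; apply HM.
      - set (G := fun y t => (csinh (X t) ^ j * kern m p q th y r t)%C).
        assert (cG : forall y, ccont (G y))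
          by (intro; apply ccont_mult; [now apply ccont_pow | apply cK]).
        assert (cG' : forall c y, ccont (fun t => c * G y t)%C)
          by (intros; apply ccont_mult; [apply ccont_const | apply cG]).
        rewrite (Cint_ext _ (fun t => / 2 * G (y + h)%R t + - / 2 * G (y + - h)%R t)%C).
        + rewrite Cint_plus, !Cint_scal by auto.
          eapply Rle_trans; [apply Cmod_triangle |].
          rewrite !Cmod_mult, Cmod_opp, Cmod_inv, Cmod_R, (Rabs_right 2)
            by (apply two_neq_0 || lra).
          assert (A1 := IH (y + h)); assert (A2 := IH (y + - h)).
          fold (G (y + h)) in A1; fold (G (y + - h)) in A2; lra.
        + intro t; unfold G; rewrite !kern_translate, RtoC_opp, Cpow_S.
          replace (- h * invw th r t)%C with (- X t)%C by (unfold X; cring).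
          fold (X t); unfold csinh at 1; field; apply two_neq_0. }
    assert (cA : forall d, ccont (fun t => arcsinh_sum d (csinh (X t)))).
    { induction d as [|d IH]; [apply (ccont_const 0) |].
      apply ccont_plus; [easy |]; apply ccont_mult; [apply ccont_const |].
      now apply (ccont_pow (fun t => csinh (X t)) (S (2 * d))). }
    (* Integrating term by term, [T] bounds each power of sinh and the coefficients telescope. *)
    assert (Sum : forall d,
      Cmod (Cint (fun t => arcsinh_sum d (csinh (X t)) * kern m p q th x r t)%C)
      <= 2 * (1 - Rabs (alpha d)) * M).
    { assert (M0 : 0 <= M) by (eapply Rle_trans; [apply Cmod_ge_0 | apply (HM 0)]).
      induction d as [|d IH].
      - rewrite (Cint_ext _ (fun t => 0 * kern m p q th x r t)%C) by easy.
        rewrite Cint_scal, Cmult_0_l, Cmod_0 by easy; simpl alpha; rewrite Rabs_R1; lra.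
      - rewrite (Cint_ext _ (fun t => arcsinh_sum d (csinh (X t)) * kern m p q th x r t
          + alpha d / (2 * INR d + 1) * (csinh (X t) ^ S (2 * d) * kern m p q th x r t))%C)
          by (intro t; rewrite arcsinh_sum_S; cring).
        assert (c1 : ccont (fun t => csinh (X t) ^ S (2 * d) * kern m p q th x r t)%C)
          by (apply ccont_mult; [now apply ccont_pow | apply cK]).
        rewrite Cint_plus, Cint_scal by (assumption || (apply ccont_mult; auto using ccont_const)).
        eapply Rle_trans; [apply Cmod_triangle |].
        rewrite Cmod_mult, Cmod_div by apply odd_neq_0.
        rewrite RtoC_2INR, !Cmod_R.
        assert (P := pos_INR d); rewrite (Rabs_right (2 * INR d + 1)) by lra.
        assert (A1 := T (S (2 * d)) x); assert (A2 := abs_alpha_telescope d).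
        assert (A3 : 0 <= Rabs (alpha d) / (2 * INR d + 1))
          by (apply Rmult_le_pos; [apply Rabs_pos | left; apply Rinv_0_lt_compat; lra]).
        apply Rle_trans with (2 * (1 - Rabs (alpha d)) * M + Rabs (alpha d) / (2 * INR d + 1) * M).
        + apply Rplus_le_compat; [easy | now apply Rmult_le_compat_l].
        + nra. }
    destruct (kern_bounded m p q th x r Hm Hp) as [K HK].
    assert (K0 : 0 <= K) by (eapply Rle_trans; [apply Cmod_ge_0 | apply (HK 0)]).
    (* Split h v into the truncated series and its remainder: the first part contributes at most 2
       M, the second at most 2 PI K 2^-d. *)
    assert (E : forall d, h * Cmod (Cint (kern m p (S q) th x 0))
      <= 2 * M + 2 * PI * K * (1/2) ^ d).
    { intro d.
      replace (h * _) with (Cmod (h * Cint (kern m p (S q) th x 0)))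
        by (rewrite Cmod_mult, Cmod_R, Rabs_right by lra; easy).
      rewrite (kern_shift m p _ th x 0 r) by easy.
      rewrite <- Cint_scal by easy.
      set (P := fun t => arcsinh_sum (S d) (csinh (X t))).
      assert (cP : ccont P) by apply cA.
      rewrite (Cint_ext _ (fun t => P t * kern m p q th x r t
        + (X t + - P t) * kern m p q th x r t)%C)
        by (intro t; rewrite kern_S; unfold X; cring).
      rewrite Cint_plus by (apply ccont_mult; auto; apply ccont_plus; auto using ccont_opp).
      eapply Rle_trans; [apply Cmod_triangle |]; apply Rplus_le_compat.
      - eapply Rle_trans; [apply Sum |].
        assert (M0 : 0 <= M) by (eapply Rle_trans; [apply Cmod_ge_0 | apply (HM 0)]).
        assert (Q := Rabs_pos (alpha (S d))); nra.
      - rewrite Rmult_assoc; apply Cint_norm.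
        + apply ccont_mult; auto; apply ccont_plus; auto using ccont_opp.
        + intro t; rewrite Cmod_mult, Rmult_comm.
          apply Rmult_le_compat; try apply Cmod_ge_0; [apply HK |].
          now apply arcsinh_sum_csinh. }
    (* [K] depends on h and x but not on d, so the remainder term vanishes as d grows. *)
    apply le_epsilon; intros eps Heps.
    assert (C0 : 0 < 2 * PI * K + 1) by (assert (Q := PI_RGT_0); nra).
    destruct (pow_lt_1_zero (1/2)) with (y := eps / (2 * PI * K + 1)) as [N HN].
    - rewrite Rabs_right; lra.
    - now apply Rdiv_lt_0_compat.
    - specialize (HN N (Nat.le_refl N)).
      rewrite Rabs_right in HN by (apply Rle_ge, pow_le; lra).
      apply Rlt_div_r in HN; [| easy].
      assert (P : 0 < (1/2) ^ N) by (apply pow_lt; lra).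
      specialize (E N); nra. }
  apply Cmod_eq_0; set (c := Cmod _) in *.
  destruct (Cmod_ge_0 (Cint (kern m p (S q) th x 0))) as [H | H]; fold c in H; [| easy].
  assert (M0 : 0 <= M) by (eapply Rle_trans; [apply Cmod_ge_0 | apply (HM 0)]).
  (* If the modulus c were positive, this h would give 2 M + 1 <= 2 M. *)
  exfalso; specialize (Bernstein ((2 * M + 1) / c)).
  replace ((2 * M + 1) / c * c) with (2 * M + 1) in Bernstein by (field; lra).
  assert (0 < (2 * M + 1) / c) by (apply Rdiv_lt_0_compat; lra).
  specialize (Bernstein H0); lra.
Qed.

Lemma bounded_derivatives_zero m p q th M : (0 < m)%nat -> (0 < p)%nat ->
  (forall x, Cmod (Cint (kern m p 0 th x 0)) <= M) ->
  forall x, Cint (kern m p (S q) th x 0) = 0%C.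
Proof.
  intros Hm Hp HM; induction q as [|q IH].
  - now apply bounded_derivative_zero with M.
  (* The preceding derivative vanishes identically, hence is bounded by 0. *)
  - apply bounded_derivative_zero with 0; try easy.
    intro x; rewrite IH, Cmod_0; apply Rle_refl.
Qed.

(** * Nonvanishing of the derivative of order p at the origin *)

(** For q = p the factor w^p v^p is the constant e^(i p th). Once it is divided out, the argument of
    the integrand is sin (m t) / m - sin (p t) / p, at most 1/2 + 1/2 < PI / 2 in absolute value
    because m and p are at least 2; so the real part is positive. *)
Lemma Cint_kern_0_neq_0 m p th : (1 < m)%nat -> (1 < p)%nat ->
  Cint (kern m p p th 0 0) <> 0%C.
Proof.
  intros Hm Hp H.
  set (f := fun t => (Cexp (0, - (INR p * th))%R * kern m p p th 0 0 t)%C).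
  assert (Hf : ccont f) by (apply ccont_mult; [apply ccont_const | apply kern_ccont]).
  assert (Z : Cint f = 0%C)
    by (unfold f; rewrite Cint_scal, H by apply kern_ccont; cring).
  rewrite Cint_pair in Z by easy.
  apply (f_equal Re) in Z; change (RInt (fun t => Re (f t)) 0 (2 * PI) = 0) in Z.
  apply (Rlt_irrefl 0); rewrite <- Z at 2.
  apply (RInt_gt_0 (fun t => Re (f t)));
    [generalize PI_RGT_0; lra | | intros t _; destruct (Hf t) as [Hc _]; exact Hc].
  intros t _; unfold f, kern; rewrite <- Cexp_plus.
  unfold Cexp; simpl; apply Rmult_lt_0_compat; [apply exp_pos |].
  unfold phase; rewrite !Rmult_0_r, !Ropp_0, exp_0.
  assert (Hm' : 2 <= INR m) by (apply (le_INR 2); lia).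
  assert (Hp' : 2 <= INR p) by (apply (le_INR 2); lia).
  assert (B : forall n, 2 <= INR n -> Rabs (sin (INR n * t) / INR n) <= 1/2).
  { intros n Hn; unfold Rdiv; rewrite Rabs_mult, (Rabs_right (/ _))
      by (apply Rle_ge, Rlt_le, Rinv_0_lt_compat; lra).
    apply Rmult_le_compat; [apply Rabs_pos | | apply Rabs_le, SIN_bound |].
    - apply Rlt_le, Rinv_0_lt_compat; lra.
    - apply Rinv_le_contravar; lra. }
  assert (B1 := B m Hm'); assert (B2 := B p Hp').
  apply Rabs_le_between in B1, B2.
  match goal with |- 0 < cos ?a =>
    replace a with (sin (INR m * t) / INR m - sin (INR p * t) / INR p) by (unfold Rdiv; ring) end.
  assert (Q := PI2_1); apply cos_gt_0; lra.
Qed.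

(** * Evenness by a half turn of the circle *)

(** The shift turns the interval into [PI, 3 PI]; periodicity carries the part beyond 2 PI back to
    [0, PI]. *)
Lemma Cint_half_turn (f : R -> C) : ccont f -> (forall t, f (t + 2 * PI) = f t) ->
  Cint (fun t => f (t + PI)) = Cint f.
Proof.
  intros Hf Hper.
  set (I := RInt (V := C_R_CompleteNormedModule) f).
  assert (E : forall a b, ex_RInt (V := C_R_NormedModule) f a b)
    by (intros; now apply ccont_ex_RInt).
  assert (Sh : forall c a b,
    RInt (V := C_R_CompleteNormedModule) (fun t => f (t + c)) a b = I (a + c) (b + c)).
  { intros c a b; unfold I.
    replace (a + c) with (1 * a + c) by ring; replace (b + c) with (1 * b + c) by ring.
    rewrite <- (RInt_comp_lin (V := C_R_CompleteNormedModule)) by apply E.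
    apply (RInt_ext (V := C_R_CompleteNormedModule)); intros t _.
    rewrite (scal_one (V := C_R_NormedModule)), Rmult_1_l; easy. }
  unfold Cint; rewrite Sh; fold (I 0 (2 * PI)).
  assert (P : I (2 * PI) (2 * PI + PI) = I 0 PI).
  { replace (2 * PI) with (0 + 2 * PI) at 1 by ring.
    replace (2 * PI + PI) with (PI + 2 * PI) by ring.
    rewrite <- Sh; apply (RInt_ext (V := C_R_CompleteNormedModule)); intros; apply Hper. }
  unfold I in *.
  rewrite <- (RInt_Chasles (V := C_R_CompleteNormedModule) f (0 + PI) (2 * PI) (2 * PI + PI))
    by apply E.
  rewrite P, Rplus_0_l, (plus_comm (G := C_R_NormedModule)).
  apply (RInt_Chasles (V := C_R_CompleteNormedModule)); apply E.
Qed.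

Lemma trig_even n t : Nat.Even n ->
  cos (INR n * (t + PI)) = cos (INR n * t) /\ sin (INR n * (t + PI)) = sin (INR n * t).
Proof.
  intros [j ->]; rewrite mult_INR; change (INR 2) with 2.
  replace (2 * INR j * (t + PI)) with (2 * INR j * t + 2 * INR j * PI) by ring.
  now rewrite cos_period, sin_period.
Qed.

(** The substitution of -w for w: v changes sign, compensated by the sign of x; the even powers are
    unchanged; and the phase gains p PI, a whole number of turns since p is even. *)
Lemma kern_half_turn m p th x r t : Nat.Even m -> Nat.Even p ->
  kern m p 0 th (- x) r (t + PI) = kern m p 0 th x r t.
Proof.
  intros Hm Hp.
  destruct (trig_even m t Hm) as [cm sm]; destruct (trig_even p t Hp) as [cp sp].
  assert (c1 : cos (th - (t + PI)) = - cos (th - t))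
    by (rewrite <- neg_cos, <- (cos_neg (th - (t + PI))), <- (cos_neg (th - t + PI)),
          <- (cos_period (- (th - t + PI)) 1);
        f_equal; simpl; ring).
  assert (s1 : sin (th - (t + PI)) = - sin (th - t))
    by (rewrite <- neg_sin, <- (sin_period (th - (t + PI)) 1); f_equal; simpl; ring).
  assert (HA : ampl m p 0 th (- x) r (t + PI) = ampl m p 0 th x r t)
    by (unfold ampl; rewrite c1, cm, cp; ring).
  assert (HB : phase m p 0 th (- x) r (t + PI) = phase m p 0 th x r t + INR p * PI)
    by (unfold phase; rewrite s1, sm, sp; simpl; ring).
  unfold kern, Cexp; simpl; rewrite HA, HB.
  destruct Hp as [j ->]; rewrite mult_INR; change (INR 2) with 2.
  now rewrite cos_period, sin_period.
Qed.

Lemma Cint_kern_even m p th x : Nat.Even m -> Nat.Even p ->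
  Cint (kern m p 0 th (- x) 0) = Cint (kern m p 0 th x 0).
Proof.
  intros Hm Hp.
  rewrite <- (Cint_half_turn (kern m p 0 th (- x) 0)).
  - apply Cint_ext; intro t; now apply kern_half_turn.
  - apply kern_ccont.
  - intro t; apply kern_periodic.
Qed.

(** * From the kernel integral back to psi *)

Lemma Cexp_Ci (a : R) : Cexp (Ci * a) = (cos a, sin a).
Proof.
  unfold Cexp; simpl.
  replace (0 * a - 1 * 0) with 0 by ring; replace (0 * 0 + 1 * a) with a by ring.
  rewrite exp_0; f_equal; ring.
Qed.

(** Parametrization with dw = i w dt. The real x may be negative, so the formula covers the whole
    line carrying a ray. *)
Lemma psi_Cint n k (th x : R) : (1 < k)%nat ->
  psi n k (x * Cexp (Ci * th)) = (/ (2 * PI) * Cint (kern (n - k + 1) (k - 1) 0 th x 0))%C.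
Proof.
  intros Hk; unfold psi, circle_integral.
  set (m := (n - k + 1)%nat); set (p := (k - 1)%nat).
  assert (Hm : 0 < INR m) by (apply lt_0_INR; unfold m; lia).
  assert (Hp : 0 < INR p) by (apply lt_0_INR; unfold p; lia).
  match goal with |- (_ * RInt ?f _ _)%C = _ =>
    change (/ (2 * PI * Ci) * Cint f = / (2 * PI) * Cint (kern m p 0 th x 0))%C end.
  rewrite (Cint_ext _ (fun t => Ci * kern m p 0 th x 0 t)%C).
  - rewrite Cint_scal by apply kern_ccont.
    field; repeat split; intro H.
    + apply RtoC_inj in H; generalize PI_RGT_0; lra.
    + apply (f_equal Im) in H; simpl in H; lra.
  - intro t.
    set (w := Cexp (Ci * t)).
    assert (W : w <> 0%C) by apply Cexp_neq_0.
    replace (k - 2)%nat with (Nat.pred p) by (unfold p; lia).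
    set (E := (_ - _ - _)%C).
    transitivity (Ci * (w ^ p * Cexp E))%C.
    (* The factor w of dw raises w^(k - 2) to w^p. *)
    { replace p with (S (Nat.pred p)) at 2 by (unfold p; lia); rewrite Cpow_S; cring. }
    assert (P : forall j, (w ^ j)%C = Cexp (Ci * (INR j * t)%R)).
    { intro j; unfold w; rewrite Cexp_pow; f_equal; rewrite RtoC_mult; cring. }
    f_equal; rewrite P, <- Cexp_plus; unfold kern; f_equal; unfold E.
    replace (x * Cexp (Ci * th) / w)%C with (x * Cexp (Ci * (th - t)%R))%C.
    2: { unfold Cdiv, w; rewrite <- Cexp_opp, <- Cmult_assoc, <- Cexp_plus.
         f_equal; f_equal; rewrite RtoC_minus; cring. }
    replace (/ (INR m * w ^ m))%C with (/ INR m * Cexp (Ci * (- (INR m * t))%R))%C.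
    2: { replace (Ci * (- (INR m * t))%R)%C with (- (Ci * (INR m * t)%R))%C by (rewrite RtoC_opp; cring).
         rewrite P, Cexp_opp; field; split; [apply Cexp_neq_0 |].
         intro H; apply RtoC_inj in H; lra. }
    rewrite P, !Cexp_Ci, cos_neg, sin_neg; unfold Cdiv; rewrite <- !RtoC_inv by lra.
    apply injective_projections; unfold ampl, phase; rewrite Ropp_0, !Rmult_0_r, Ropp_0, exp_0;
      simpl; unfold Rdiv; ring.
Qed.

Lemma polar (z : C) : exists r th : R, z = (r * Cexp (Ci * th))%C.
Proof.
  destruct (Req_dec (Cmod z) 0) as [H | H].
  - exists 0, 0; apply Cmod_eq_0 in H; rewrite H; cring.
  - assert (Hz : 0 < Cmod z) by (assert (P := Cmod_ge_0 z); lra).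
    set (c := Re z / Cmod z); set (s := Im z / Cmod z).
    assert (E : c * c + s * s = 1).
    { unfold c, s; assert (Q := Cmod2_alt z).
      transitivity ((Re z ^ 2 + Im z ^ 2) / Cmod z ^ 2); [field; lra |].
      rewrite <- Q; field; lra. }
    assert (B : -1 <= c <= 1) by nra.
    assert (T : exists th, cos th = c /\ sin th = s).
    { destruct (Rle_dec 0 s) as [Hs | Hs].
      - exists (acos c); split; [now apply cos_acos |].
        rewrite sin_acos by easy; apply sqrt_lem_1; unfold Rsqr; nra.
      - exists (- acos c); rewrite cos_neg, sin_neg; split; [now apply cos_acos |].
        rewrite sin_acos by easy.
        rewrite (sqrt_lem_1 _ (- s)); unfold Rsqr; nra. }
    destruct T as [th [Hc Hs]]; exists (Cmod z), th.
    rewrite Cexp_Ci, Hc, Hs; unfold c, s.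
    apply injective_projections; simpl; unfold Re, Im; field; lra.
Qed.

Theorem theorem8 (n k : nat) (hk : (1 < k)%nat) (hkn : (k < n)%nat)
  (hn : Nat.Even n) (hko : Nat.Odd k) :
  even_function (psi n k) /\
  forall theta : R, unbounded_on (psi n k) (ray theta).
Proof.
  assert (Hm : Nat.Even (n - k + 1)).
  { destruct hn as [a ->], hko as [b ->]; exists (a - b)%nat; lia. }
  assert (Hp : Nat.Even (k - 1)) by (destruct hko as [b ->]; exists b; lia).
  assert (Hm1 : (1 < n - k + 1)%nat) by lia.
  assert (Hp1 : (1 < k - 1)%nat) by (destruct hko; lia).
  split.
  - intro z; destruct (polar z) as [r [th ->]].
    replace (- (r * Cexp (Ci * th)))%C with ((- r)%R * Cexp (Ci * th))%C
      by (rewrite RtoC_opp; cring).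
    now rewrite !psi_Cint, Cint_kern_even.
  - intros th M; apply NNPP; intro Hno.
    (* If no point of the ray has |psi| > M, the kernel integral is bounded by 2 PI M on the
       half-line. *)
    assert (B : forall x, 0 <= x -> Cmod (Cint (kern (n - k + 1) (k - 1) 0 th x 0)) <= 2 * PI * M).
    { intros x Hx; apply Rnot_lt_le; intro Hlt; apply Hno.
      exists (x * Cexp (Ci * th))%C; split; [now exists x |].
      assert (P := PI_RGT_0).
      rewrite psi_Cint, Cmod_mult, <- RtoC_mult, <- RtoC_inv, Cmod_R by (easy || lra).
      rewrite Rabs_right by (apply Rle_ge, Rlt_le, Rinv_0_lt_compat; lra).
      apply Rmult_lt_reg_l with (2 * PI); [lra |].
      rewrite <- Rmult_assoc, Rinv_r, Rmult_1_l by lra; easy. }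
    apply (Cint_kern_0_neq_0 (n - k + 1) (k - 1) th Hm1 Hp1).
    (* The order [S (k - 2)] is p = k - 1, the one whose value at 0 is nonzero. *)
    assert (Z := bounded_derivatives_zero (n - k + 1) (k - 1) (k - 2) th (2 * PI * M)).
    replace (S (k - 2)) with (k - 1)%nat in Z by lia.
    apply Z; try lia.
    (* Evenness extends the bound from the ray to the whole line. *)
    intro x; destruct (Rle_dec 0 x) as [Hx | Hx]; [now apply B |].
    rewrite <- Cint_kern_even by easy; apply B; lra.
Qed.
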